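(* Let $0<\gamma<1$, $\alpha,\beta\in\mathbb{R}$, and let $(T_k)_{k=1}^\infty$ be a sequence of positive reals with $T_k\to\infty$. Assume that the sequence of empirical measures $(\delta^{T_k}_{A^+,\tau_{\alpha,\beta}\Gamma})_{k=1}^\infty$ exhibits $\gamma$-escape of mass, i.e. \[ \limsup_{k\to\infty}\delta^{T_k}_{A^+,\tau_{\alpha,\beta}\Gamma}(K)\leq 1-\gamma \] for every compact subset $K\subset X$. Then for any $0<\varepsilon<1/2$, \[ \liminf_{k\to\infty}\frac{(\log T_k)^2}{T_k^2}\left|\left\{n\in\mathbb{N}\ \middle|\ n<e^{2T_k},\ n\langle n\alpha\rangle\langle n\beta\rangle<\varepsilon\right\}\right|\geq\frac{\gamma}{18}. \]
   Context: $G=\mathrm{SL}(3,\mathbb{R})$, $\Gamma=\mathrm{SL}(3,\mathbb{Z})$, $X=G/\Gamma$, with $G$ acting by left multiplication. For $s,t\in\mathbb{R}$, $a_{s,t}=\mathrm{diag}(e^{-s-t},e^s,e^t)$, and $A^+=\{a_{s,t}: s,t\ge 0\}$. For $x\in X$ and $T>0$, the empirical measure is $\delta^T_{A^+,x}=\frac{1}{T^2}\int_{[0,T]^2}\delta_{a_{s,t}x}\,ds\,dt$. For $(\alpha,\beta)\in\mathbb{R}^2$, $\tau_{\alpha,\beta}$ is the lower triangular unipotent matrix with first column $(1,\alpha,\beta)^t$ and other columns $(0,1,0)^t,(0,0,1)^t$. $\langle x\rangle$ denotes the distance from $x\in\mathbb{R}$ to the nearest integer. *)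

(* Defs.v *)
From HB Require Import structures.
From mathcomp Require Import all_boot all_order all_algebra.
From mathcomp Require Import all_classical all_reals all_analysis.
Set Implicit Arguments. Unset Strict Implicit. Unset Printing Implicit Defensive.
Import Order.TTheory GRing.Theory Num.Theory.
Import numFieldNormedType.Exports.
Local Open Scope classical_set_scope.
Local Open Scope ring_scope.

(* Points of X = SL(3,R)/SL(3,Z) are cosets g Gamma;
   a subset of X is represented by its (right-Gamma-invariant) preimage in G. *)

Section Defs.
Variable R : realType.

Definition SL3 : set 'M[R]_3 := [set g | \det g = 1].

Definition SL3Z : set 'M[R]_3 :=
  [set g | \det g = 1 /\ forall i j, g i j \is a Num.int].

Definition Xsubset (K : set 'M[R]_3) : Prop :=
  K `<=` SL3 /\ forall g gam, K g -> SL3Z gam -> K (g *m gam).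

Definition openG (U : set 'M[R]_3) : Prop :=
  U `<=` SL3 /\
  forall g, U g -> exists2 e : R, 0 < e &
    forall h, SL3 h -> (forall i j, `|h i j - g i j| < e) -> U h.

(* open subsets of X for the quotient topology: Gamma-invariant open subsets of G *)
Definition openX (U : set 'M[R]_3) : Prop := Xsubset U /\ openG U.

Definition compactX (K : set 'M[R]_3) : Prop :=
  Xsubset K /\
  forall (I : Type) (U : I -> set 'M[R]_3),
    (forall i, openX (U i)) -> K `<=` \bigcup_(i in setT) U i ->
    exists2 F : set I, finite_set F & K `<=` \bigcup_(i in F) U i.

Definition a_st (s t : R) : 'M[R]_3 :=
  \matrix_(i < 3, j < 3)
    if i == j then nth 0 [:: expR (- s - t); expR s; expR t] i else 0.

Definition tau (al be : R) : 'M[R]_3 :=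
  \matrix_(i < 3, j < 3)
    if i == j then 1
    else if (val j == 0)%N then nth 0 [:: 0; al; be] i else 0.

Definition empirical (T : R) (x : 'M[R]_3) (K : set 'M[R]_3) : \bar R :=
  ((T ^+ 2)^-1)%:E *
  ((@lebesgue_measure R) \x (@lebesgue_measure R))%E
    ([set st : R * R | [/\ 0 <= st.1 <= T, 0 <= st.2 <= T &
                         K (a_st st.1 st.2 *m x)]])%R.

Definition distZ (x : R) : R :=
  Num.min (x - (Num.floor x)%:~R) ((Num.ceil x)%:~R - x).

(* |{ n in N (n >= 1) | n < e^{2T}, n <n al> <n be> < eps }| ; the range
   1 .. trunc(e^{2T})+1 contains every positive n < e^{2T}. *)
Definition count_small (T al be eps : R) : nat :=
  size [seq n <- iota 1 (Num.truncn (expR (2 * T))).+1 |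
          (n%:R < expR (2 * T)) &&
          (n%:R * distZ (n%:R * al) * distZ (n%:R * be) < eps)].

End Defs.

(* Main.v *)
Require Import Defs.
From HB Require Import structures.
From mathcomp Require Import all_boot all_order all_algebra.
From mathcomp Require Import all_classical all_reals all_analysis.
From mathcomp Require Import finmap measurable_realfun ring lra.
Import Order.TTheory GRing.Theory Num.Theory.
Import numFieldNormedType.Exports.
Local Open Scope classical_set_scope.
Local Open Scope ring_scope.
Set Implicit Arguments. Unset Strict Implicit. Unset Printing Implicit Defensive.

(* A lattice in the orbit is far out in the cusp exactly when it contains a short
   vector, and for [a_st s t *m tau al be] such a vector lies over some
   [n < e^(2T)] with [n <n al> <n be>] small; the times [(s, t)] at which the
   vector over [n] is short form a triangle. If one triangle (cut by the box) has
   side more than [6 log T], then the first [T^2] multiples of [n] are all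
   counted. Otherwise every triangle has area at most [18 (log T)^2], and since
   the triangles cover a proportion [gam] of [[0, T]^2], at least about
   [gam T^2 / (18 (log T)^2)] of them are needed.

   That the lattices without short vectors form a compact set (Mahler) is proved by
   LLL reduction: a basis almost minimizing the potential [llldet] over its
   [SL(3, Z)]-orbit, once size-reduced, has entries bounded in terms of the
   systole. *)

(** * Three by three matrices and their Gram determinants *)

Section MatricesOfSizeThree.
Variable R : realType.
Implicit Types g h u : 'M[R]_3.

Definition i0 : 'I_3 := @Ordinal 3 0 isT.
Definition i1 : 'I_3 := @Ordinal 3 1 isT.
Definition i2 : 'I_3 := @Ordinal 3 2 isT.

Lemma ord3P (P : 'I_3 -> Prop) : P i0 -> P i1 -> P i2 -> forall i, P i.
Proof.
move=> p0 p1 p2 [[|[|[|//]]] lti].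
- by rewrite (_ : Ordinal lti = i0) //; exact: val_inj.
- by rewrite (_ : Ordinal lti = i1) //; exact: val_inj.
- by rewrite (_ : Ordinal lti = i2) //; exact: val_inj.
Qed.

Lemma sum3E (V : nmodType) (F : 'I_3 -> V) : \sum_i F i = F i0 + F i1 + F i2.
Proof.
rewrite !big_ord_recl big_ord0 addr0 addrA.
by congr (F _ + F _ + F _); exact: val_inj.
Qed.

Lemma det3E h : \det h =
  h i0 i0 * (h i1 i1 * h i2 i2 - h i1 i2 * h i2 i1)
  - h i0 i1 * (h i1 i0 * h i2 i2 - h i1 i2 * h i2 i0)
  + h i0 i2 * (h i1 i0 * h i2 i1 - h i1 i1 * h i2 i0).
Proof.
have E i j : h i j = h (inord i) (inord j) by rewrite !inord_val.
rewrite (expand_det_row _ i0) sum3E /cofactor.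
rewrite !(expand_det_row _ ord0) !big_ord_recl !big_ord0 /cofactor !det_mx11.
rewrite !mxE /= !(E (lift _ _)) !(E i0) !(E i1) !(E i2) /=.
rewrite /bump /= !addn0 ?add1n ?addn1 ?expr0 ?expr1 ?sqrrN ?mul1r ?addr0.
ring.
Qed.



Definition mx3 (r0 r1 r2 : seq R) : 'M[R]_3 :=
  \matrix_(i, j) nth 0 (nth [::] [:: r0; r1; r2] i) j.

Lemma mulmx3E h u i j :
  (h *m u) i j = h i i0 * u i0 j + h i i1 * u i1 j + h i i2 * u i2 j.
Proof. by rewrite mxE sum3E. Qed.

Lemma SL3Z_mul g h : SL3Z g -> SL3Z h -> SL3Z (g *m h).
Proof.
move=> [dg zg] [dh zh]; split; first by rewrite det_mulmx dg dh mulr1.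
by move=> i j; rewrite mulmx3E !rpredD ?rpredM.
Qed.

(** Scalar products of columns: [SL(3, Z)] acts on the right, so the columns of [h] form a basis of
    the lattice. *)
Definition gram h i j : R := h i0 i * h i0 j + h i1 i * h i1 j + h i2 i * h i2 j.

Definition minor2 h : R := gram h i0 i0 * gram h i1 i1 - gram h i0 i1 ^+ 2.

(** The LLL potential: product of the squared covolumes spanned by the first column and by the first
    two. The full covolume is constant on an orbit and is left out. *)
Definition llldet h : R := gram h i0 i0 * minor2 h.

Lemma gram_ge0 h i : 0 <= gram h i i.
Proof. by rewrite /gram -!expr2 !addr_ge0 ?sqr_ge0. Qed.

Lemma sqr_entry_le_gram h i j : h i j ^+ 2 <= gram h j j.
Proof.
rewrite /gram -!expr2.
have := sqr_ge0 (h i0 j); have := sqr_ge0 (h i1 j); have := sqr_ge0 (h i2 j).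
by elim/ord3P: i => ? ? ?; lra.
Qed.

(** Sylvester's identity for the Gram matrix, whose determinant is [\det h ^+ 2]. *)
Lemma gram_sylvester h :
  minor2 h * (gram h i0 i0 * gram h i2 i2 - gram h i0 i2 ^+ 2) =
  (gram h i0 i0 * gram h i1 i2 - gram h i0 i1 * gram h i0 i2) ^+ 2
  + gram h i0 i0 * (\det h) ^+ 2.
Proof. by rewrite det3E /minor2 /gram; ring. Qed.

(** Lagrange's identity for the cross product of the first two columns. *)
Lemma minor2_crossE h : minor2 h =
  (h i1 i0 * h i2 i1 - h i2 i0 * h i1 i1) ^+ 2
  + (h i2 i0 * h i0 i1 - h i0 i0 * h i2 i1) ^+ 2
  + (h i0 i0 * h i1 i1 - h i1 i0 * h i0 i1) ^+ 2.
Proof. by rewrite /minor2 /gram; ring. Qed.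

Lemma cauchy_schwarz3 (a b c x y z : R) :
  (a * x + b * y + c * z) ^+ 2 <=
  (a ^+ 2 + b ^+ 2 + c ^+ 2) * (x ^+ 2 + y ^+ 2 + z ^+ 2).
Proof.
have := sqr_ge0 (a * y - b * x); have := sqr_ge0 (a * z - c * x).
have := sqr_ge0 (b * z - c * y); rewrite -!(subr_ge0 ((_ + _ + _) ^+ 2)).
move=> p q r; have -> : (a ^+ 2 + b ^+ 2 + c ^+ 2) * (x ^+ 2 + y ^+ 2 + z ^+ 2)
  - (a * x + b * y + c * z) ^+ 2 =
  (a * y - b * x) ^+ 2 + (a * z - c * x) ^+ 2 + (b * z - c * y) ^+ 2 by ring.
by rewrite !addr_ge0.
Qed.

Lemma sqr_int_ge1 (x : R) : x \is a Num.int -> x != 0 -> 1 <= x ^+ 2.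
Proof.
move=> xZ x0; have := norm_intr_ge1 xZ x0 => h.
by rewrite -real_normK ?num_real // -[1](expr1n _ 2) lerXn2r ?nnegrE.
Qed.

(* The cross product of the first two columns of [g *m u], paired with the
   columns of [g], gives the (integral) cross product of those of [u]. *)
Lemma minor2_orbit_ge g u : SL3 g -> SL3Z u ->
  1 <= minor2 (g *m u) * (gram g i0 i0 + gram g i1 i1 + gram g i2 i2).
Proof.
move=> dg [du zu].
pose w0 := u i1 i0 * u i2 i1 - u i2 i0 * u i1 i1.
pose w1 := u i2 i0 * u i0 i1 - u i0 i0 * u i2 i1.
pose w2 := u i0 i0 * u i1 i1 - u i1 i0 * u i0 i1.
have duE : w0 * u i0 i2 + w1 * u i1 i2 + w2 * u i2 i2 = 1.
  by rewrite -du det3E /w0 /w1 /w2; ring.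
(* The vector [w] is integral, and nonzero by [duE]. *)
have wge1 : 1 <= w0 ^+ 2 + w1 ^+ 2 + w2 ^+ 2.
  have wZ : [/\ w0 \is a Num.int, w1 \is a Num.int & w2 \is a Num.int].
    by split; rewrite rpredB ?rpredM.
  case: wZ => z0 z1 z2; have [e0|n0] := eqVneq w0 0; last first.
    by have := sqr_int_ge1 z0 n0; have := sqr_ge0 w1; have := sqr_ge0 w2; lra.
  have [e1|n1] := eqVneq w1 0; last first.
    by have := sqr_int_ge1 z1 n1; have := sqr_ge0 w0; have := sqr_ge0 w2; lra.
  have [e2|n2] := eqVneq w2 0; last first.
    by have := sqr_int_ge1 z2 n2; have := sqr_ge0 w0; have := sqr_ge0 w1; lra.
  by move: duE; rewrite e0 e1 e2 !mul0r !addr0 => /esym/eqP; rewrite oner_eq0.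
apply: (le_trans wge1); rewrite minor2_crossE.
pose h := g *m u.
pose c0 := h i1 i0 * h i2 i1 - h i2 i0 * h i1 i1.
pose c1 := h i2 i0 * h i0 i1 - h i0 i0 * h i2 i1.
pose c2 := h i0 i0 * h i1 i1 - h i1 i0 * h i0 i1.
have cE j (w : R) : \det g * w = c0 * g i0 j + c1 * g i1 j + c2 * g i2 j ->
    w ^+ 2 <= (c0 ^+ 2 + c1 ^+ 2 + c2 ^+ 2) * gram g j j.
  by rewrite dg mul1r /gram -!expr2 => ->; exact: cauchy_schwarz3.
rewrite 2!mulrDr.
apply: lerD; first apply: lerD; [apply: (cE i0)|apply: (cE i1)|apply: (cE i2)].
- by rewrite det3E /c0 /c1 /c2 /h !mulmx3E /w0; ring.
- by rewrite det3E /c0 /c1 /c2 /h !mulmx3E /w1; ring.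
- by rewrite det3E /c0 /c1 /c2 /h !mulmx3E /w2; ring.
Qed.

(** * LLL reduction in dimension three *)

Lemma round_sub (x a : R) : 0 < a ->
  exists2 k : R, k \is a Num.int & (x + k * a) ^+ 2 <= a ^+ 2 / 4.
Proof.
move=> a0; pose z := Num.floor (x / a + 2^-1); exists (- z%:~R).
  by rewrite rpredN intr_int.
have /andP[] := floor_itv (x / a + 2^-1); rewrite -/z intrD.
set r := z%:~R : R; set t := x / a => h1 h2.
have -> : x = t * a by rewrite /t mulfVK ?gt_eqF.
have -> : t * a + - r * a = (t - r) * a by ring.
rewrite exprMn mulrC ler_wpM2l ?sqr_ge0 //.
have : 0 <= (2^-1 - (t - r)) * (2^-1 + (t - r)) by apply: mulr_ge0; lra. lra.
Qed.

(** The LLL moves as right multipliers: [unip3] adds multiples of earlier columns to later ones, the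
    swaps exchange neighbouring columns, with a sign that keeps the determinant 1. *)
Definition unip3 (k l m : R) : 'M[R]_3 := mx3 [:: 1; k; m] [:: 0; 1; l] [:: 0; 0; 1].
Definition swap01 : 'M[R]_3 := mx3 [:: 0; -1; 0] [:: 1; 0; 0] [:: 0; 0; 1].
Definition swap12 : 'M[R]_3 := mx3 [:: 1; 0; 0] [:: 0; 0; -1] [:: 0; 1; 0].

Lemma SL3Z_unip3 k l m : k \is a Num.int -> l \is a Num.int -> m \is a Num.int ->
  SL3Z (unip3 k l m).
Proof.
move=> kZ lZ mZ; split; first by rewrite det3E !mxE /=; ring.
by elim/ord3P; elim/ord3P; rewrite mxE /= ?rpred0 ?rpred1.
Qed.

Lemma SL3Z_swap01 : SL3Z swap01.
Proof.
split; first by rewrite det3E !mxE /=; ring.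
by elim/ord3P; elim/ord3P; rewrite mxE /= ?rpredN ?rpred0 ?rpred1.
Qed.

Lemma SL3Z_swap12 : SL3Z swap12.
Proof.
split; first by rewrite det3E !mxE /=; ring.
by elim/ord3P; elim/ord3P; rewrite mxE /= ?rpredN ?rpred0 ?rpred1.
Qed.

Lemma llldet_swap01 h : llldet (h *m swap01) = gram h i1 i1 * minor2 h.
Proof. by rewrite /llldet !minor2_crossE /gram !mulmx3E !mxE /=; ring. Qed.

Lemma llldet_swap12 h : llldet (h *m swap12) =
  gram h i0 i0 * (gram h i0 i0 * gram h i2 i2 - gram h i0 i2 ^+ 2).
Proof. by rewrite /llldet /minor2 /gram !mulmx3E !mxE /=; ring. Qed.

(** Unipotent column operations preserve the flag, hence the potential. The three bounds say, with
    denominators cleared, that the Gram-Schmidt coefficients are at most 1/2 in absolute value. *)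
Lemma size_reduction h : 0 < gram h i0 i0 -> 0 < minor2 h ->
  exists u, [/\ SL3Z u, llldet (h *m u) = llldet h,
    gram (h *m u) i0 i1 ^+ 2 <= gram (h *m u) i0 i0 ^+ 2 / 4,
    gram (h *m u) i0 i2 ^+ 2 <= gram (h *m u) i0 i0 ^+ 2 / 4 &
    (gram (h *m u) i0 i0 * gram (h *m u) i1 i2
     - gram (h *m u) i0 i1 * gram (h *m u) i0 i2) ^+ 2 <= minor2 (h *m u) ^+ 2 / 4].
Proof.
move=> A0 m0.
have [k kZ hk] := round_sub (gram h i0 i1) A0.
have [l lZ hl] :=
  round_sub (gram h i0 i0 * gram h i1 i2 - gram h i0 i1 * gram h i0 i2) m0.
(* [m] is rounded last, because adding [l] times column [i1] to column [i2] shifts the product with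
   column [i0]. *)
have [m mZ hm] := round_sub (gram h i0 i2 + l * gram h i0 i1) A0.
exists (unip3 k l m).
have E00 : gram (h *m unip3 k l m) i0 i0 = gram h i0 i0.
  by rewrite /gram !mulmx3E !mxE /=; ring.
have E01 : gram (h *m unip3 k l m) i0 i1 = gram h i0 i1 + k * gram h i0 i0.
  by rewrite /gram !mulmx3E !mxE /=; ring.
have E02 : gram (h *m unip3 k l m) i0 i2 =
    gram h i0 i2 + l * gram h i0 i1 + m * gram h i0 i0.
  by rewrite /gram !mulmx3E !mxE /=; ring.
have Em : minor2 (h *m unip3 k l m) = minor2 h.
  by rewrite !minor2_crossE !mulmx3E !mxE /=; ring.
have E12 : gram (h *m unip3 k l m) i1 i2 = gram h i1 i2 + l * gram h i1 i1
    + m * gram h i0 i1 + k * gram h i0 i2 + k * l * gram h i0 i1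
    + k * m * gram h i0 i0.
  by rewrite /gram !mulmx3E !mxE /=; ring.
split; first exact: SL3Z_unip3.
- by rewrite /llldet E00 Em.
- by rewrite E00 E01.
- by rewrite E00 E02.
- rewrite Em; apply: le_trans hl; rewrite le_eqVlt; apply/orP; left; apply/eqP.
  by rewrite E00 E01 E02 E12 /minor2; ring.
Qed.

(** The two Lovasz inequalities give [A ^+ 2 <= 2 * m] and, the determinant being 1,
    [m ^+ 2 <= 2 * A]. So [A] and [m] are at most 2, and [q <= A] controls the denominators in [b]
    and [c]. *)
Lemma reduced_gram_bound (q A b c x y m e : R) : 0 < q -> q <= A -> 0 < m ->
  m = A * b - x ^+ 2 -> x ^+ 2 <= A ^+ 2 / 4 -> y ^+ 2 <= A ^+ 2 / 4 ->
  e ^+ 2 <= m ^+ 2 / 4 -> m * (A * c - y ^+ 2) = e ^+ 2 + A ->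
  3 / 4 * A <= b -> 3 / 4 * m <= A * c - y ^+ 2 ->
  [/\ A <= 2 + 2 / q + 2 / q ^+ 2, b <= 2 + 2 / q + 2 / q ^+ 2 &
      c <= 2 + 2 / q + 2 / q ^+ 2].
Proof.
move=> q0 qA m0 mE hx hy he hm hb hc.
have A0 : 0 < A by lra.
have Am : A ^+ 2 <= 2 * m.
  have : 0 <= A * (b - 3 / 4 * A) by apply: mulr_ge0; lra. lra.
have mA : m ^+ 2 <= 2 * A.
  have : 0 <= m * (A * c - y ^+ 2 - 3 / 4 * m) by apply: mulr_ge0; lra. lra.
have A2 : A <= 2.
  rewrite leNgt; apply/negP => A2.
  have : 2 * A < A ^+ 2 by rewrite expr2 ltr_pM2r.
  move=> ?; have : A < m by lra.
  move=> Am'; have : A ^+ 2 < m ^+ 2 by rewrite ltrXn2r // ltW.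
  lra.
have m2 : m <= 2.
  rewrite leNgt; apply/negP => m2.
  have : 2 * m < m ^+ 2 by rewrite expr2 ltr_pM2r.
  lra.
have iq0 : 0 < q^-1 by rewrite invr_gt0.
have iA : A^-1 <= q^-1 by rewrite lef_pV2.
have iA0 : 0 < A^-1 by rewrite invr_gt0.
have q2 : 2 / q ^+ 2 = 2 * q^-1 ^+ 2 by rewrite exprVn.
have im : m^-1 <= 2 * q^-1 ^+ 2.
  have -> : 2 * q^-1 ^+ 2 = (q ^+ 2 / 2)^-1 by field; rewrite gt_eqF.
  rewrite lef_pV2 ?posrE ?divr_gt0 ?exprn_gt0 //.
  have : q ^+ 2 <= A ^+ 2 by rewrite lerXn2r ?nnegrE // ltW.
  lra.
rewrite q2; have iq2 : 0 < q^-1 ^+ 2 by rewrite exprn_gt0.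
have mi : m / A <= 2 * q^-1 by rewrite ler_pM // ltW.
split; first lra.
- have -> : b = m / A + x ^+ 2 / A by rewrite mE; field; rewrite gt_eqF.
  have : x ^+ 2 / A <= A / 4.
    by rewrite ler_pdivrMr // (_ : A / 4 * A = A ^+ 2 / 4) //; ring.
  lra.
(* Squared lengths of the three Gram-Schmidt components of the last column. *)
- have -> : c = y ^+ 2 / A + (e ^+ 2 / m / A + m^-1).
    have -> : e ^+ 2 = m * (A * c - y ^+ 2) - A by lra.
    by field; rewrite !gt_eqF.
  have : y ^+ 2 / A <= A / 4.
    by rewrite ler_pdivrMr // (_ : A / 4 * A = A ^+ 2 / 4) //; ring.
  have : e ^+ 2 / m / A <= m / A / 4.
    rewrite ler_pdivrMr // ler_pdivrMr //.
    by rewrite (_ : m / A / 4 * A * m = m ^+ 2 / 4) //; field; rewrite gt_eqF.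
  lra.
Qed.

Definition systole_ge (d : R) : set 'M[R]_3 :=
  [set g | SL3 g /\ forall v : 'cV[R]_3, (forall i, v i 0 \is a Num.int) ->
    v != 0 -> d ^+ 2 <= \sum_i ((g *m v) i 0) ^+ 2].

Lemma systole_ge_Xsubset d : Xsubset (systole_ge d).
Proof.
split=> [g []//|g u [dg hg] [du zu]]; split.
  by rewrite /SL3 /= det_mulmx dg du mulr1.
move=> v vZ v0; rewrite -mulmxA; apply: hg.
  by move=> i; rewrite mxE rpred_sum // => j _; rewrite rpredM.
apply: contra_neq v0 => uv0.
have uU : u \in unitmx by rewrite unitmxE du unitr1.
by rewrite -[v](mulKmx uU) uv0 mulmx0.
Qed.

Lemma systole_ge_gram d g : systole_ge d g -> d ^+ 2 <= gram g i0 i0.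
Proof.
move=> [_ hg]; have := hg (delta_mx i0 0).
rewrite sum3E /gram -!expr2 !mxE !sum3E !mxE /= !mulr1 !mulr0 !addr0; apply.
  by move=> i; rewrite mxE; case: eqP; case: eqP.
by apply/eqP => /matrixP/(_ i0 0); rewrite !mxE /= => /eqP; rewrite oner_eq0.
Qed.

(** The potential is bounded below by [d ^+ 2 / trg] on the orbit, so its infimum is positive. A
    basis close enough to the infimum cannot be much improved by a swap, which is the Lovasz
    condition; size reduction leaves its potential unchanged. *)
Lemma bounded_representative d g : 0 < d -> systole_ge d g ->
  exists2 u, SL3Z u & forall i j,
    ((g *m u) i j) ^+ 2 <= 2 + 2 / d ^+ 2 + 2 / (d ^+ 2) ^+ 2.
Proof.
move=> d0 Kg; have [dg _] := Kg.
have [_ invK] := systole_ge_Xsubset d.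
pose trg := gram g i0 i0 + gram g i1 i1 + gram g i2 i2.
have d2 : 0 < d ^+ 2 by rewrite exprn_gt0.
have SL1 : SL3Z (1%:M : 'M[R]_3).
  split=> [|i j]; first by rewrite det1.
  by rewrite mxE; case: eqP.
have tr0 : 0 < trg.
  have := minor2_orbit_ge dg SL1; rewrite -/trg mulmx1.
  have := addr_ge0 (addr_ge0 (gram_ge0 g i0) (gram_ge0 g i1)) (gram_ge0 g i2).
  rewrite -/trg.
  by rewrite le_eqVlt => /orP[/eqP t0|//]; rewrite -t0 mulr0 ler10.
have orb u : SL3Z u -> [/\ d ^+ 2 <= gram (g *m u) i0 i0, 0 < minor2 (g *m u) &
    d ^+ 2 / trg <= llldet (g *m u)].
  move=> zu; have h1 := systole_ge_gram (invK _ _ Kg zu).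
  have h2 := minor2_orbit_ge dg zu; rewrite -/trg in h2.
  have m1 : trg^-1 <= minor2 (g *m u) .
    by rewrite -(ler_pM2r tr0) mulVf ?gt_eqF.
  have m0 : 0 < minor2 (g *m u) by apply: lt_le_trans m1; rewrite invr_gt0.
  split=> //; apply: ler_pM => //; first exact: ltW.
  by rewrite invr_ge0 ltW.
pose E := [set llldet (g *m u) | u in @SL3Z R].
have E0 : E !=set0 by exists (llldet (g *m 1%:M)), 1%:M.
have lbE : lbound E (d ^+ 2 / trg) by move=> _ [u zu <-]; have [] := orb u zu.
have infE : has_inf E by split => //; exists (d ^+ 2 / trg).
have I0 : 0 < inf E.
  by apply: lt_le_trans (lb_le_inf E0 lbE); rewrite divr_gt0.
(* A potential below 4/3 of the infimum produces the Lovasz constant 3/4. *)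
have [|_ [u zu <-] near] := inf_adherent (eps := inf E / 3) _ infE.
  by rewrite divr_gt0.
have [A0 m0 _] := orb u zu.
have [u' [zu' ED hx hy he]] := size_reduction (lt_le_trans d2 A0) m0.
have zuu' := SL3Z_mul zu zu'; exists (u *m u') => //.
have [] := orb _ zuu'; rewrite mulmxA.
set h := g *m u *m u' in ED hx hy he *; move=> qA m0' _.
have dh : \det h = 1 by rewrite /h -mulmxA det_mulmx dg zuu'.1 mulr1.
have min w : SL3Z w -> 3 / 4 * llldet h <= llldet (h *m w).
  move=> zw; have : inf E <= llldet (h *m w).
    apply: ge_inf; first by case: infE.
    by exists (u *m u' *m w); [exact: SL3Z_mul | rewrite /h !mulmxA].
  by rewrite ED; lra.
have A0' : 0 < gram h i0 i0 by apply: lt_le_trans qA.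
have hb : 3 / 4 * gram h i0 i0 <= gram h i1 i1.
  have := min _ SL3Z_swap01.
  by rewrite llldet_swap01 /llldet mulrA ler_pM2r.
have hc : 3 / 4 * minor2 h <= gram h i0 i0 * gram h i2 i2 - gram h i0 i2 ^+ 2.
  have := min _ SL3Z_swap12.
  by rewrite llldet_swap12 /llldet mulrCA ler_pM2l.
have hs := gram_sylvester h; rewrite dh expr1n mulr1 in hs.
have [b0 b1 b2] := reduced_gram_bound d2 qA m0' erefl hx hy he hs hb hc.
move=> i j; apply: le_trans (sqr_entry_le_gram h i j) _.
by elim/ord3P: j.
Qed.

End MatricesOfSizeThree.

(** * Mahler's compactness criterion *)

Section Compactness.
Variable R : realType.
Local Notation vec9 := ('rV[R]_(3 * 3)).

Lemma vec_mxE (v : vec9) i j : vec_mx v i j = v 0 (mxvec_index i j).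
Proof. by rewrite -mxvecE vec_mxK. Qed.

Lemma continuous_vec_mx i j : continuous (fun v : vec9 => vec_mx v i j : R).
Proof.
rewrite (_ : (fun v => _) = (fun v : vec9 => v 0 (mxvec_index i j) : R)).
  exact: coord_continuous.
by apply/funext => v; rewrite vec_mxE.
Qed.

Lemma continuous_add (F G : vec9 -> R) :
  continuous F -> continuous G -> continuous (fun v => F v + G v).
Proof. by move=> cF cG v; exact: (cvgD (cF v) (cG v)). Qed.

Lemma continuous_mul (F G : vec9 -> R) :
  continuous F -> continuous G -> continuous (fun v => F v * G v).
Proof. by move=> cF cG v; exact: (cvgM (cF v) (cG v)). Qed.

Lemma continuous_opp (F : vec9 -> R) :
  continuous F -> continuous (fun v => - F v).
Proof. by move=> cF v; exact: (cvgN (cF v)). Qed.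

Lemma closed_ge_continuous (F : vec9 -> R) (c : R) :
  continuous F -> closed [set v | c <= F v].
Proof.
move=> cF; rewrite (_ : [set _ | _] = F @^-1` [set x | c <= x]) //.
by apply: closed_comp => // x _; exact: cF.
Qed.

Lemma closed_le_continuous (F : vec9 -> R) (c : R) :
  continuous F -> closed [set v | F v <= c].
Proof.
move=> cF; rewrite (_ : [set _ | _] = F @^-1` [set x | x <= c]) //.
by apply: closed_comp => // x _; exact: cF.
Qed.

(** Matrices are flattened to row vectors, for which closed and bounded sets are compact. *)
Definition bounded_systole_ge (d B : R) : set vec9 :=
  [set v | systole_ge d (vec_mx v) /\ forall i j, vec_mx v i j ^+ 2 <= B].

Lemma closed_bounded_systole_ge d B : closed (bounded_systole_ge d B).
Proof.
pose Z := [set w : 'cV[R]_3 | (forall i, w i 0 \is a Num.int) /\ w != 0].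
rewrite (_ : bounded_systole_ge d B =
  [set v | 1 <= \det (vec_mx v : 'M[R]_3)]
  `&` [set v | \det (vec_mx v : 'M[R]_3) <= 1]
  `&` (\bigcap_(w in Z) [set v | d ^+ 2 <= \sum_i ((vec_mx v *m w) i 0) ^+ 2])
  `&` (\bigcap_(ij in @setT ('I_3 * 'I_3)%type)
        [set v | vec_mx v ij.1 ij.2 ^+ 2 <= B])); last first.
  apply/seteqP; split => v /=.
    move=> [[dv Kv] Bv]; rewrite dv lexx; split; first split=> //.
      by move=> w [wZ w0]; exact: Kv.
    by move=> [i j] _; exact: Bv.
  move=> [[[h1 h2] Kv] Bv]; split.
    split; first by apply/eqP; rewrite eq_le h1 h2.
    by move=> w wZ w0; exact: (Kv w).
  by move=> i j; exact: (Bv (i, j)).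
have cdet : continuous (fun v : vec9 => \det (vec_mx v : 'M[R]_3)).
  under eq_fun do rewrite det3E.
  have c := continuous_vec_mx.
  have m a b a' b' e f e' f' : continuous (fun v : vec9 =>
      vec_mx v a b * vec_mx v a' b' - vec_mx v e f * vec_mx v e' f' : R).
    exact: (continuous_add (continuous_mul (c a b) (c a' b'))
                  (continuous_opp (continuous_mul (c e f) (c e' f')))).
  exact: (continuous_add (continuous_add (continuous_mul (c i0 i0) (m _ _ _ _ _ _ _ _))
    (continuous_opp (continuous_mul (c i0 i1) (m _ _ _ _ _ _ _ _))))
    (continuous_mul (c i0 i2) (m _ _ _ _ _ _ _ _))).
have closedI (A C : set vec9) : closed A -> closed C -> closed (A `&` C).
  by move=> cA cC x clx; split; [apply: cA | apply: cC];
    apply: closure_subset clx => ? [].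
apply: closedI; first apply: closedI; first apply: closedI.
- exact: closed_ge_continuous.
- exact: closed_le_continuous.
- apply: closed_bigI => w _; apply: closed_ge_continuous.
  have c i : continuous (fun v : vec9 => (vec_mx v *m w) i 0 ^+ 2 : R).
    under eq_fun do rewrite expr2 mxE sum3E.
    have l : continuous (fun v : vec9 => vec_mx v i i0 * w i0 0
        + vec_mx v i i1 * w i1 0 + vec_mx v i i2 * w i2 0 : R).
      have k j : continuous (fun v : vec9 => vec_mx v i j * w j 0 : R).
        apply: (continuous_mul (@continuous_vec_mx i j)).
        exact: (@cst_continuous vec9 R).
      exact: (continuous_add (continuous_add (k i0) (k i1)) (k i2)).
    exact: (continuous_mul l l).
  under eq_fun do rewrite sum3E.
  exact: (continuous_add (continuous_add (c i0) (c i1)) (c i2)).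
- apply: closed_bigI => ij _; apply: closed_le_continuous.
  under eq_fun do rewrite expr2.
  exact: (continuous_mul (@continuous_vec_mx _ _) (@continuous_vec_mx _ _)).
Qed.

Lemma compact_bounded_systole_ge d B : compact (bounded_systole_ge d B).
Proof.
apply: bounded_closed_compact; last exact: closed_bounded_systole_ge.
(* From [x ^+ 2 <= B] and [0 <= (|x| - 1) ^+ 2] follows [2 * |x| <= B + 1]. *)
exists (B + 1); split; first exact: num_real.
move=> M BM v [_ Bv] /=.
rewrite /Num.norm /= mx_normrE; apply: bigmax_le => [|[i j] _ /=].
  have := Bv i0 i0; have := sqr_ge0 (vec_mx v i0 i0); lra.
rewrite ord1; have [a b] := mxvec_indexP j.
rewrite -vec_mxE; have := Bv a b; set x := vec_mx v a b => hx.
have : 0 <= (`|x| - 1) ^+ 2 by exact: sqr_ge0.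
have : `|x| ^+ 2 <= B by rewrite real_normK ?num_real.
have := normr_ge0 x; move=> *; nra.
Qed.

(** Openness in [openG] is relative to [SL3]; this is an open set of the ambient space that contains
    an open [U] and meets [SL3] inside it. *)
Definition thicken (U : set 'M[R]_3) : set vec9 :=
  [set v | exists2 e : R, 0 < e & forall h, SL3 h ->
     (forall i j, `|h i j - vec_mx v i j| < e) -> U h].

Lemma open_thicken U : open (thicken U).
Proof.
rewrite openE => v [e e0 he].
have e20 : 0 < e / 2 by rewrite divr_gt0.
apply: filterS (nbhsx_ballx v _ e20) => w vw; exists (e / 2) => // h Sh hw.
apply: he => // i j.
rewrite -(subrK (vec_mx w i j) (h i j)) -addrA.
apply: le_lt_trans (ler_normD _ _) _.
rewrite (splitr e) ltrD //.
rewrite distrC !vec_mxE.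
exact: vw.2.
Qed.

(** Every orbit meets the compact set of bounded representatives. A finite subcover of that set
    covers everything, since the open sets are [SL3Z]-invariant. *)
Lemma compactX_systole_ge (d : R) : 0 < d -> compactX (systole_ge d).
Proof.
move=> d0; split; first exact: systole_ge_Xsubset.
move=> I U oU Ucov.
have := @compact_bounded_systole_ge d (2 + 2 / d ^+ 2 + 2 / (d ^+ 2) ^+ 2).
(* [{classic I}] gives the arbitrary index type the choice structure required for finite
   subcovers. *)
rewrite compact_cover => /(_ {classic I} setT (fun i => thicken (U i))) [].
- by move=> i _; exact: open_thicken.
- move=> v [Kv _]; have [i _ Ui] := Ucov _ Kv; exists i => //.
  by have [_ [_]] := oU i; exact.
move=> F _ FC; exists ([set` F]%classic : set {classic I}).
  exact: (@finite_fset {classic I} F).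
move=> g Kg; have [u zu bu] := bounded_representative d0 Kg.
have Kgu := (systole_ge_Xsubset d).2 _ _ Kg zu.
have : bounded_systole_ge d (2 + 2 / d ^+ 2 + 2 / (d ^+ 2) ^+ 2) (mxvec (g *m u)).
  by rewrite /bounded_systole_ge /= mxvecK.
move=> /FC[i Fi [e e0 he]]; exists i => //.
have Uu : U i (g *m u).
  by apply: he => [|a b]; [case: Kgu | rewrite mxvecK subrr normr0].
have uU : u \in unitmx by rewrite unitmxE zu.1 unitr1.
(* Return from [g *m u] to [g] by the inverse of [u], integral because it is the adjugate. *)
rewrite -[g](mulmxK uU); apply: (oU i).1.2 => //.
split; first by rewrite det_inv zu.1 invr1.
move=> a b; rewrite /invmx uU zu.1 invr1 scale1r mxE /cofactor rpredM //.
  by rewrite rpredX // rpredN rpred1.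
rewrite /determinant rpred_sum // => s _; rewrite rpredM ?rpredX ?rpredN ?rpred1 //.
by rewrite rpred_prod // => k _; rewrite !mxE; exact: zu.2.
Qed.

End Compactness.

(** * Distance to the nearest integer, and multiples of a good approximation *)

Section Arithmetic.
Variable R : realType.
Implicit Types x d s t T al be eps : R.

Lemma distZ_ge0 x : 0 <= distZ x.
Proof. by rewrite /distZ le_min !subr_ge0 floor_le ceil_ge. Qed.

Lemma distZ_le x (m : int) : distZ x <= `|x + m%:~R|.
Proof.
rewrite -[m]opprK mulrNz; set k := - m.
rewrite /distZ ge_min; have [kx|xk] := leP k%:~R x.
  apply/orP; left; rewrite ger0_norm ?subr_ge0 // lerB // ler_int.
  by rewrite floor_ge_int.
apply/orP; right; rewrite ltr0_norm ?subr_lt0 // opprB lerB // ler_int.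
by rewrite ceil_le_int // ltW.
Qed.

Lemma distZ_attained x : exists m : int, distZ x = `|x + m%:~R|.
Proof.
rewrite /distZ minEle; case: ifP => _.
  exists (- Num.floor x); rewrite mulrNz ger0_norm // subr_ge0 floor_le //.
exists (- Num.ceil x).
by rewrite mulrNz ler0_norm ?opprB // subr_le0 ceil_ge.
Qed.

Lemma distZ_natM x (k : nat) : distZ (k%:R * x) <= k%:R * distZ x.
Proof.
have [m ->] := distZ_attained x.
apply: le_trans (distZ_le _ (k%:Z * m)) _.
by rewrite intrM -mulrDr normrM normr_nat.
Qed.

(** The list whose size is [count_small], named so that unions can be indexed by it. *)
Definition counted T al be eps : seq nat :=
  [seq n <- iota 1 (Num.truncn (expR (2 * T))).+1 |
          (n%:R < expR (2 * T)) &&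
          (n%:R * distZ (n%:R * al) * distZ (n%:R * be) < eps)].

Lemma counted_mem T al be eps n : (0 < n)%N -> n%:R < expR (2 * T) ->
  n%:R * distZ (n%:R * al) * distZ (n%:R * be) < eps -> n \in counted T al be eps.
Proof.
move=> n0 nT ne; rewrite mem_filter nT ne mem_iota n0 /= add1n ltnS.
by apply: leqW; rewrite truncn_ge_nat ?expR_ge0 // ltW.
Qed.

Lemma counted_gt0 T al be eps n : n \in counted T al be eps -> (0 < n)%N.
Proof. by rewrite mem_filter mem_iota => /andP[_ /andP[]]. Qed.

(* A single very good approximation produces many: its first [T ^ 2] multiples. *)
Lemma count_small_multiples T al be eps n : 1 <= T -> 0 < eps < 1 -> (0 < n)%N ->
  n%:R * T ^+ 6 <= eps * expR (2 * T) ->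
  n%:R * distZ (n%:R * al) * distZ (n%:R * be) * T ^+ 6 <= eps ^+ 3 ->
  T ^+ 2 - 1 <= (count_small T al be eps)%:R.
Proof.
move=> T1 /andP[e0 e1] n0 h1 h2.
have T0 : 0 <= T by lra.
set K := Num.truncn (T ^+ 2).
have KT : T ^+ 2 - 1 <= K%:R.
  have := truncnS_gt (T ^+ 2); rewrite -/K -natr1; lra.
apply: (le_trans KT); rewrite ler_nat.
have -> : K = size [seq (k * n)%N | k <- iota 1 K] by rewrite size_map size_iota.
apply: uniq_leq_size.
  rewrite map_inj_in_uniq ?iota_uniq // => a b _ _ /eqP.
  by rewrite eqn_pmul2r // => /eqP.
move=> x /mapP[k]; rewrite mem_iota add1n ltnS => /andP[k0 kK] ->.
have kT : k%:R <= T ^+ 2 :> R.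
  by apply: le_trans (_ : K%:R <= _); rewrite ?ler_nat // truncn_le ?exprn_ge0.
have n0R : 0 < n%:R :> R by rewrite ltr0n.
have kT6 : k%:R * n%:R <= n%:R * T ^+ 6.
  rewrite mulrC ler_pM2l //; apply: (le_trans kT).
  by rewrite ler_weXn2l.
apply: counted_mem; first by rewrite muln_gt0 k0.
  rewrite natrM; apply: le_lt_trans kT6 _; apply: le_lt_trans h1 _.
  by rewrite gtr_pMl ?expR_gt0.
have e3 : eps ^+ 3 < eps by rewrite exprS gtr_pMr // exprn_ilt1 // ltW.
apply: le_lt_trans e3; apply: le_trans h2.
rewrite natrM -(mulrA k%:R n%:R al) -(mulrA k%:R n%:R be).
have ha := distZ_natM (n%:R * al) k; have hb := distZ_natM (n%:R * be) k.
have k0R : 0 <= k%:R :> R by rewrite ler0n.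
set a := distZ (n%:R * al) in ha *; set b := distZ (n%:R * be) in hb *.
apply: (@le_trans _ _ (k%:R * n%:R * (k%:R * a) * (k%:R * b))).
  apply: ler_pM => //; rewrite ?distZ_ge0 ?mulr_ge0 ?distZ_ge0 //.
  by apply: ler_wpM2l => //; rewrite mulr_ge0.
(* Each of the three factors grows by at most [k] from [n] to [k * n], and [k ^ 3 <= T ^ 6]. *)
have -> : k%:R * n%:R * (k%:R * a) * (k%:R * b) = n%:R * a * b * k%:R ^+ 3 by ring.
rewrite ler_wpM2l ?mulr_ge0 ?distZ_ge0 //.
by rewrite (exprM T 2 3) lerXn2r ?nnegrE ?exprn_ge0.
Qed.

(** The witness is the minimum of [T] and [ln (d / x)]; the case [x = 0], where the logarithm would
    be infinite, falls under [T]. *)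
Lemma threshold x d T : 0 <= x -> 0 < d ->
  exists sx, [/\ sx <= T, expR sx * x <= d &
    forall s, s <= T -> expR s * x < d -> s <= sx].
Proof.
move=> x0 d0; have [h|h] := leP (expR T * x) d; first by exists T; split.
have xp : 0 < x.
  by rewrite lt_neqAle x0 andbT; apply: contraTneq h => <-; rewrite mulr0 -leNgt ltW.
have dx : d / x \in Num.pos by rewrite posrE divr_gt0.
exists (ln (d / x)); split.
- by rewrite -ler_expR lnK // ler_pdivrMr // ltW.
- by rewrite lnK // divfK ?gt_eqF.
- by move=> s _ hs; rewrite -ler_expR lnK // ler_pdivlMr // ltW.
Qed.

End Arithmetic.

(** * Area of a right isosceles triangle *)

Section Measure.
Variable R : realType.
Implicit Types (s t T d al be eps : R) (n : nat).
Local Notation mu := (@lebesgue_measure R).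
Local Notation mu2 := (mu \x mu)%E.

Lemma integral_ramp (a b : R) : a < b ->
  (\int[mu]_(x in `[a, b]) (x - a)%:E = ((b - a) ^+ 2 / 2)%:E)%E.
Proof.
move=> ab; pose F : R -> R := 2^-1 *: (id - cst a) ^+ 2.
have FE x : F x = (x - a) ^+ 2 / 2 by rewrite /F /= mulrC.
have dF (x : R) : is_derive x 1 F (x - a).
  apply: is_derive_eq.
  by rewrite subr0 /GRing.scale /= expr1 mulr1 mulKf ?pnatr_eq0.
have cF : continuous F.
  by move=> x; apply/differentiable_continuous/derivable1_diffP; case: (dF x).
rewrite (@continuous_FTC2 _ (fun x => x - a) F) //.
- by rewrite !FE subrr expr0n /= mul0r -EFinB subr0.
- apply: continuous_subspaceT => x.
  by apply: cvgB; [exact: cvg_id | exact: cvg_cst].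
- split; first by move=> x _; case: (dF x).
  + exact/cvg_at_right_filter/cF.
  + exact/cvg_at_left_filter/cF.
- by move=> x _; rewrite derive1E; case: (dF x).
Qed.

(** The section over [x <= p] is the interval from [c - x] to [q], so the area integrates a ramp.
    The triangle may be empty, hence a bound by [l] instead of an equality. *)
Lemma measure_triangle_le (p q c l : R) : 0 <= l -> p + q - c <= l ->
  (mu2 [set st | [/\ st.1 <= p, st.2 <= q & c <= st.1 + st.2]]%R
     <= (l ^+ 2 / 2)%:E)%E.
Proof.
move=> l0 hl; rewrite /product_measure1 /=.
set A := [set st | _].
have sE x : xsection A x = if x <= p then `[c - x, q]%classic else set0.
  apply/seteqP; split => y; rewrite xsectionE /A /=.
    by move=> [-> h1 h2]; rewrite /= in_itv /= h1 andbT lerBlDl.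
  case: ifP => // xp; rewrite /= in_itv /= => /andP[h1 h2]; split => //.
  by rewrite -lerBlDl.
have mE x : mu (xsection A x) =
    (((fun x => (x - (c - q))%:E) \_ `[(c - q), p]) x).
  rewrite sE patchE; have [xp|xp] := leP x p; last first.
    by rewrite measure0 memNset //= in_itv /= (leNgt x) xp andbF.
  rewrite lebesgue_measure_itv /= lte_fin; have [h|h] := ltP.
    rewrite mem_set; last by rewrite /= in_itv /= xp andbT; lra.
    by rewrite -EFinB; congr (_%:E); ring.
  case: ifPn => [/set_mem|//]; rewrite /= in_itv /= xp andbT => h'.
  by congr (_%:E); lra.
have [h|h] := ltP (c - q) p.
  under eq_integral do rewrite mE.
  rewrite -integral_mkcond integral_ramp // lee_fin ler_pM2r // lerXn2r ?nnegrE //.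
    by lra.
  by lra.
rewrite integral0_eq ?lee_fin ?divr_ge0 ?exprn_ge0 // => x _.
rewrite mE patchE; case: ifPn => [/set_mem|//]; rewrite /= in_itv /= => /andP[h1 h2].
by congr (_%:E); lra.
Qed.

End Measure.

(** * Short vectors along the flow *)

Section ShortVectors.
Variable R : realType.
Implicit Types (s t T d al be eps : R) (n : nat).
Local Notation mu := (@lebesgue_measure R).
Local Notation mu2 := (mu \x mu)%E.

(** The least squared length among the images under the flow of integer vectors with first
    coordinate [n]: the other two coordinates are chosen as nearest integers. *)
Definition shortness al be n (st : R * R) : R :=
  (expR (- st.1 - st.2) * n%:R) ^+ 2 + (expR st.1 * distZ (n%:R * al)) ^+ 2
  + (expR st.2 * distZ (n%:R * be)) ^+ 2.

Definition short_times al be d T n : set (R * R) :=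
  [set st | [/\ 0 <= st.1 <= T, 0 <= st.2 <= T & shortness al be n st < d ^+ 2]].

Lemma flow_mulE s t al be (v : 'cV[R]_3) :
  \sum_i ((a_st s t *m tau al be *m v) i 0) ^+ 2 =
  (expR (- s - t) * v i0 0) ^+ 2 + (expR s * (v i0 0 * al + v i1 0)) ^+ 2
  + (expR t * (v i0 0 * be + v i2 0)) ^+ 2.
Proof.
rewrite sum3E !mxE !sum3E !mxE !sum3E !mxE /=.
by rewrite !(mul0r, mulr0, add0r, addr0, mulr1); ring.
Qed.

Lemma SL3_flow s t al be : SL3 (a_st s t *m tau al be).
Proof.
rewrite /SL3 /= det_mulmx !det3E !mxE /= !(mul0r, mulr0, subr0, addr0, mulr1).
by rewrite mulrA -!expRD (_ : _ + t = 0) ?expR0 //; ring.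
Qed.

(** For [s, t >= 0] the last two directions are not contracted, so a nonzero integer vector with
    first coordinate 0 keeps length at least 1. Any shorter one has, up to sign, a positive first
    coordinate. *)
Lemma shortnessP s t al be d : 0 < d < 1 -> 0 <= s -> 0 <= t ->
  ~ systole_ge d (a_st s t *m tau al be) <->
  exists2 n, (0 < n)%N & shortness al be n (s, t) < d ^+ 2.
Proof.
move=> /andP[d0 d1] s0 t0; have d21 : d ^+ 2 < 1 by rewrite exprn_ilt1 // ltW.
have sq (x y z : R) : 0 <= x -> 0 <= y <= `|z| -> (x * y) ^+ 2 <= (x * z) ^+ 2.
  move=> x0 /andP[y0 yz]; rewrite -(real_normK (num_real (x * z))) normrM.
  by rewrite lerXn2r ?nnegrE ?mulr_ge0 // (ger0_norm x0) ler_wpM2l.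
split; last first.
  move=> [n n0 sn] [_ /=].
  have [m1 E1] := distZ_attained (n%:R * al).
  have [m2 E2] := distZ_attained (n%:R * be).
  pose v : 'cV[R]_3 := \col_i nth 0 [:: n%:R; m1%:~R; m2%:~R] i.
  move=> /(_ v); rewrite flow_mulE !mxE /= => h.
  have : d ^+ 2 <= shortness al be n (s, t).
    apply: le_trans (h _ _) _.
    - by elim/ord3P; rewrite mxE /=.
    - apply/eqP => /matrixP/(_ i0 0); rewrite !mxE /= => /eqP.
      by rewrite pnatr_eq0 gtn_eqF.
    - by rewrite /shortness E1 E2 /= !exprMn !real_normK ?num_real.
  by rewrite leNgt sn.
move=> /not_andP[|/existsNP[v /not_implyP[vZ /not_implyP[v0]]]].
  by have := SL3_flow s t al be.
move=> /negP; rewrite -ltNge flow_mulE => h.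
have /intrP[z0 zE0] := vZ i0; have /intrP[z1 zE1] := vZ i1.
have /intrP[z2 zE2] := vZ i2.
have [z00|z0n] := eqVneq z0 0.
  exfalso; move: h; rewrite zE0 z00 !mul0r mulr0 expr0n /= !add0r zE1 zE2.
  have big (x : R) (z : int) : 0 <= x -> z != 0 -> 1 <= (expR x * z%:~R) ^+ 2.
    move=> x0 zn; rewrite exprMn.
    have h1 : 1 <= expR x ^+ 2 by rewrite exprn_ege1 // -expR0 ler_expR.
    have h2 : 1 <= (z%:~R : R) ^+ 2 by rewrite sqr_int_ge1 ?intr_int ?intr_eq0.
    exact: mulr_ege1.
  have [z10|/(big _ _ s0) h1] := eqVneq z1 0; last first.
    by have := sqr_ge0 (expR t * z2%:~R); lra.
  have [z20|/(big _ _ t0) h2] := eqVneq z2 0; last first.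
    by have := sqr_ge0 (expR s * z1%:~R); lra.
  case/eqP: v0; apply/matrixP => i j; rewrite ord1 mxE.
  by elim/ord3P: i; rewrite ?zE0 ?zE1 ?zE2 ?z00 ?z10 ?z20.
exists `|z0|%N; first by rewrite absz_gt0.
apply: le_lt_trans h; rewrite /shortness /=.
have nE : `|z0|%:R = `|v i0 0| :> R by rewrite zE0 natr_absz intr_norm.
have dle x (w : int) : distZ (`|z0|%:R * x) <= `|v i0 0 * x + w%:~R|.
  rewrite nE; have [vp|vn] := leP 0 (v i0 0); first by rewrite (ger0_norm vp) distZ_le.
  rewrite (ltr0_norm vn); apply: le_trans (distZ_le _ (- w)) _.
  by rewrite mulrNz mulNr -opprD normrN.
rewrite zE1 zE2; apply: lerD; first apply: lerD.
- by apply: sq; rewrite ?expR_ge0 // nE normr_ge0 lexx.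
- by apply: sq; rewrite ?expR_ge0 // distZ_ge0 dle.
- by apply: sq; rewrite ?expR_ge0 // distZ_ge0 dle.
Qed.

Lemma shortness_lt al be d n s t : 0 < d -> shortness al be n (s, t) < d ^+ 2 ->
  [/\ expR (- s - t) * n%:R < d, expR s * distZ (n%:R * al) < d &
      expR t * distZ (n%:R * be) < d].
Proof.
move=> d0; rewrite /shortness /=.
set a := expR (- s - t) * n%:R; set b := expR s * _; set c := expR t * _ => h.
have h2 (x : R) : x ^+ 2 < d ^+ 2 -> x < d.
  move=> xd; rewrite ltNge; apply/negP => dx; move: xd; rewrite ltNge => /negP; apply.
  apply: lerXn2r => //; rewrite nnegrE; first exact: ltW.
  exact: le_trans (ltW d0) dx.
have := sqr_ge0 a; have := sqr_ge0 b; have := sqr_ge0 c => *.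
by split; apply: h2; lra.
Qed.

(** The exponents sum to zero, so multiplying the three coordinate bounds gives a product below
    [eps ^+ 3], while the first alone gives [n < expR (s + t)]. *)
Lemma short_times_counted al be eps T n st : 0 < eps < 1 -> (0 < n)%N ->
  short_times al be eps T n st -> n \in counted T al be eps.
Proof.
move=> /andP[e0 e1] n0; case: st => s t [/= /andP[s0 sT] /andP[t0 tT]] h.
have [h1 h2 h3] := shortness_lt e0 h.
have n0R : 0 < n%:R :> R by rewrite ltr0n.
have nE : n%:R = expR (s + t) * (expR (- s - t) * n%:R).
  by rewrite mulrA -expRD (_ : s + t + _ = 0) ?expR0 ?mul1r //; ring.
apply: counted_mem => //.
  rewrite nE; apply: (@lt_le_trans _ _ (expR (s + t))).
    by rewrite gtr_pMr ?expR_gt0 //; lra.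
  by rewrite ler_expR; lra.
set a := distZ (n%:R * al) in h2 *; set b := distZ (n%:R * be) in h3 *.
have a0 : 0 <= a by exact: distZ_ge0.
have b0 : 0 <= b by exact: distZ_ge0.
have -> : n%:R * a * b = expR (- s - t) * n%:R * (expR s * a) * (expR t * b).
  rewrite [X in X * a * b = _]nE expRD; ring.
have e3 : eps * eps * eps < eps.
  by rewrite -mulrA gtr_pMr // mulr_ilt1 // ltW.
apply: le_lt_trans e3; apply: ler_pM; last exact: ltW.
- by rewrite !mulr_ge0 ?expR_ge0 // ltW.
- by rewrite mulr_ge0 ?expR_ge0.
apply: ler_pM; rewrite ?(ltW h1) ?(ltW h2) ?mulr_ge0 ?expR_ge0 // ltW //.
Qed.

Lemma measurable_short_times al be d T n :
  measurable (short_times al be d T n : set (R * R)).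
Proof.
rewrite (_ : short_times al be d T n =
  (`[0, T]%classic `*` `[0, T]%classic) `&` [set st | shortness al be n st < d ^+ 2]).
  apply: measurableI; first exact: measurableX.
  have mf : measurable_fun setT (shortness al be n : R * R -> R).
    have m1 : measurable_fun setT (fst : R * R -> R).
      exact: measurable_fst.
    have m2 : measurable_fun setT (snd : R * R -> R).
      exact: measurable_snd.
    have mE (f : R * R -> R) (k : R) : measurable_fun setT f ->
        measurable_fun setT (fun st => (expR (f st) * k) ^+ 2).
      move=> mf; apply: measurable_funX; apply: measurable_funM => //.
      exact: (measurableT_comp (@measurable_expR R) mf).
    apply: measurable_funD; first apply: measurable_funD.
    - apply: (mE (fun st => - st.1 - st.2)); apply: measurable_funB => //.
      exact: measurableT_comp.
    - exact: mE.
    - exact: mE.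
  have /(_ measurableT [set true]) := measurable_fun_ltr mf (measurable_cst (d ^+ 2)).
  rewrite setTI => h; have := h I.
  by congr (measurable _); apply/seteqP; split => st /=.
apply/seteqP; split => st /=.
  by move=> [h1 h2 h3]; split => //; split; rewrite /= in_itv.
by move=> [[]]; rewrite /= !in_itv.
Qed.

(** By [shortnessP] the complement is a union over all positive [n]; [short_times_counted] reduces
    it to a finite one, with one [eps] serving as systole bound and as counting threshold. *)
Lemma recurrent_timesE T al be eps : 0 < eps < 1 ->
  [set st : R * R | [/\ 0 <= st.1 <= T, 0 <= st.2 <= T &
     systole_ge eps (a_st st.1 st.2 *m tau al be)]] =
  (`[0, T]%classic `*` `[0, T]%classic) `\`
    \big[setU/set0]_(n <- counted T al be eps) short_times al be eps T n.
Proof.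
move=> he; apply/seteqP; split => -[s t] /=.
  move=> [hs ht Ks]; split; first by split; rewrite /= in_itv.
  rewrite -bigcup_seq => -[n /= nL [_ _ sn]].
  have [_] := shortnessP al be he (proj1 (andP hs)) (proj1 (andP ht)).
  by apply=> //; exists n => //; exact: counted_gt0 nL.
move=> [[]]; rewrite /= !in_itv /= => hs ht hn; split => //.
apply: contrapT => /(shortnessP al be he (proj1 (andP hs)) (proj1 (andP ht)))[n n0 sn].
have En : short_times al be eps T n (s, t) by split.
by apply: hn; rewrite -bigcup_seq; exists n => //; exact: short_times_counted En.
Qed.

(* The short times lie in the triangle [s <= sx], [t <= tx], [c <= s + t] cut out
   by the thresholds of the three coordinates. Either its side is at most
   [6 * ln T], or the corner [(sx, tx)] shows that [n] is a very good approximation. *)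
Lemma short_times_dichotomy al be d T n : 0 < d -> 1 <= T -> (0 < n)%N ->
  [/\ n%:R * T ^+ 6 <= d * expR (2 * T) &
      n%:R * distZ (n%:R * al) * distZ (n%:R * be) * T ^+ 6 <= d ^+ 3] \/
  (mu2 (short_times al be d T n) <= (18 * ln T ^+ 2)%:E)%E.
Proof.
move=> d0 T1 n0; have n0R : 0 < n%:R :> R by rewrite ltr0n.
have T0 : 0 < T by lra.
have a0 := distZ_ge0 (n%:R * al); have b0 := distZ_ge0 (n%:R * be).
have [sx [sT sd smax]] := threshold T a0 d0.
have [tx [tT td tmax]] := threshold T b0 d0.
(* Shortness of the first coordinate forces [c <= s + t], so the side of the triangle is
   [sx + tx - c]. *)
pose c := ln (n%:R / d); have cE : expR c = n%:R / d by rewrite lnK // posrE divr_gt0.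
have lT : 0 <= ln T by rewrite ln_ge0.
have [h|h] := leP (sx + tx - c) (6 * ln T); last first.
  left; have key : n%:R * T ^+ 6 <= d * expR (sx + tx).
    have : expR (c + 6 * ln T) <= expR (sx + tx) by rewrite ler_expR; lra.
    rewrite expRD cE mulrC (_ : expR (6 * ln T) = T ^+ 6); last first.
      by rewrite expRM_natl lnK.
    by rewrite mulrA ler_pdivrMr // mulrC [X in _ <= X]mulrC.
  split.
    by apply: (le_trans key); rewrite ler_pM2l // ler_expR; lra.
  set a := distZ _ in a0 sd *; set b := distZ _ in b0 td *.
  rewrite (_ : n%:R * a * b * T ^+ 6 = n%:R * T ^+ 6 * (a * b)); last ring.
  apply: (@le_trans _ _ (d * expR (sx + tx) * (a * b))).
    by rewrite ler_wpM2r // mulr_ge0.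
  (* At the corner each distance times its exponential is at most [d]. *)
  rewrite expRD (_ : d * _ * _ = d * ((expR sx * a) * (expR tx * b))); last ring.
  rewrite exprS expr2 ler_pM2l //.
  by apply: ler_pM; rewrite ?mulr_ge0 ?expR_ge0.
(* The constant 18 is half the square of 6. *)
right; have -> : 18 * ln T ^+ 2 = (6 * ln T) ^+ 2 / 2 by field.
have l0 : 0 <= 6 * ln T by rewrite mulr_ge0.
apply: le_trans (measure_triangle_le l0 h).
apply: le_measure.
- by apply: mem_set; exact: (@measurable_short_times al be d T n).
- apply/mem_set; have m1 : measurable_fun setT (fst : R * R -> R).
    exact: measurable_fst.
  have m2 : measurable_fun setT (snd : R * R -> R).
    exact: measurable_snd.
  have le (f g : R * R -> R) : measurable_fun setT f ->
      measurable_fun setT g -> measurable [set x | f x <= g x].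
    move=> mf mg; have /(_ measurableT [set true]) := measurable_fun_ler mf mg.
    rewrite setTI => k; have := k I.
    by congr (measurable _); apply/seteqP; split => st /=.
  rewrite (_ : [set _ | _] = [set x : R * R | x.1 <= sx] `&`
    [set x : R * R | x.2 <= tx] `&` [set x : R * R | c <= x.1 + x.2]).
    apply: measurableI; first by apply: measurableI; exact: le.
    by apply: le => //; exact: measurable_funD.
  by apply/seteqP; split => x /= [] // [].
- move=> [s t] [/= /andP[s0 sT'] /andP[t0 tT']] /(shortness_lt d0)[h1 h2 h3].
  split; [exact: smax | exact: tmax | rewrite /=].
  rewrite -ler_expR cE ler_pdivrMr //.
  rewrite (_ : n%:R = expR (s + t) * (expR (- s - t) * n%:R)).
    by rewrite ler_pM2l ?expR_gt0 // ltW.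
  by rewrite mulrA -expRD (_ : s + t + _ = 0) ?expR0 ?mul1r //; ring.
Qed.

End ShortVectors.

(** * Comparing areas in the square *)

Section Counting.
Variable R : realType.
Implicit Types (T eps al be : R).
Local Notation mu := (@lebesgue_measure R).
Local Notation mu2 := (mu \x mu)%E.

Lemma measure_bigsetU_le (L : seq nat) (F : nat -> set (R * R)) (c : R) :
  (forall n, measurable (F n)) -> (forall n, n \in L -> (mu2 (F n) <= c%:E)%E) ->
  (mu2 (\big[setU/set0]_(n <- L) F n) <= ((size L)%:R * c)%:E)%E.
Proof.
move=> mF; elim: L => [|n L IH] hF.
  by rewrite big_nil measure0 /= mul0r.
rewrite big_cons /= -natr1 mulrDl mul1r addrC EFinD.
have mL : measurable (\big[setU/set0]_(n <- L) F n).
  by apply: bigsetU_measurable => i _; exact: mF.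
apply: (@le_trans _ _ (mu2 (F n) + mu2 (\big[setU/set0]_(n <- L) F n))%E).
  by apply: measureU2; [exact: mF | exact: mL].
apply: leeD; first by apply: hF; rewrite mem_head.
by apply: IH => m mL'; apply: hF; rewrite inE mL' orbT.
Qed.

Lemma measure_square T : 0 < T ->
  mu2 (`[0, T]%classic `*` `[0, T]%classic) = (T ^+ 2)%:E.
Proof.
move=> T0; rewrite product_measure1E //= lebesgue_measure_itv /= lte_fin T0.
by rewrite -EFinB subr0 -EFinM -expr2.
Qed.

(** The set whose area [empirical] normalizes for [K = systole_ge eps]. *)
Definition recurrent_times al be eps T : set (R * R) :=
  [set st | [/\ 0 <= st.1 <= T, 0 <= st.2 <= T &
                systole_ge eps (a_st st.1 st.2 *m tau al be)]].

(** The second alternative is subadditivity over the square, written as a sum to avoid subtracting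
    extended reals. *)
Lemma count_small_or_recurrent al be eps T : 0 < eps < 1 -> 1 <= T ->
  T ^+ 2 - 1 <= (count_small T al be eps)%:R \/
  ((T ^+ 2)%:E <= mu2 (recurrent_times al be eps T)
     + ((count_small T al be eps)%:R * (18 * ln T ^+ 2))%:E)%E.
Proof.
move=> he T1; have e0 : 0 < eps by case/andP: he.
set L := counted T al be eps.
have [[n nL nbig]|allsmall] := pselect (exists2 n, n \in L &
    ~ (mu2 (short_times al be eps T n) <= (18 * ln T ^+ 2)%:E)%E).
  left; have n0 := counted_gt0 nL.
  have [[h1 h2]|//] := short_times_dichotomy al be e0 T1 n0.
  exact: (count_small_multiples T1 he n0 h1 h2).
right; have mE n : measurable (short_times al be eps T n).
  exact: measurable_short_times.
have hL n : n \in L -> (mu2 (short_times al be eps T n) <= (18 * ln T ^+ 2)%:E)%E.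
  by move=> nL; apply: contrapT => h; apply: allsmall; exists n.
have := measure_bigsetU_le mE hL.
set U := \big[setU/set0]_(n <- L) _ => hU.
have mU : measurable U by apply: bigsetU_measurable => i _; exact: mE.
have mB : measurable (`[0, T]%classic `*` `[0, T]%classic : set (R * R)).
  by apply: measurableX; exact: measurable_itv.
have rE : recurrent_times al be eps T = (`[0, T]%classic `*` `[0, T]%classic) `\` U.
  exact: recurrent_timesE.
have mK : measurable (recurrent_times al be eps T).
  by rewrite rE; exact: measurableD.
rewrite -measure_square; last by lra.
apply: (@le_trans _ _ (mu2 (recurrent_times al be eps T) + mu2 U)%E); last first.
  exact: leeD2l.
apply: (@le_trans _ _ (mu2 (recurrent_times al be eps T `|` U))); last first.
  by apply: measureU2; [exact: mK | exact: mU].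
apply: le_measure; [exact: mem_set | apply: mem_set; exact: measurableU |].
by rewrite rE setDE setUIl setUCl setIT => x; left.
Qed.

(** * Upper and lower limits, and the final estimate *)

Lemma limn_esup_lt (u : (\bar R)^nat) (b : \bar R) :
  (limn_esup u < b)%E -> \forall k \near \oo, (u k < b)%E.
Proof.
rewrite /limn_esup /limf_esup => /ereal_inf_lt[_ [V FV <-]] h.
apply: filterS FV => k Vk; apply: le_lt_trans h.
by apply: ereal_sup_ubound; exists k.
Qed.

Lemma limn_einf_ge (u : (\bar R)^nat) (b : R) :
  (\forall k \near \oo, (b%:E <= u k)%E) -> (b%:E <= limn_einf u)%E.
Proof.
move=> FV; rewrite /limn_einf leeNr /limn_esup /limf_esup.
apply: ereal_inf_le; eexists.
  exists [set k | (b%:E <= u k)%E]; [exact: FV | reflexivity].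
by apply: ub_ereal_sup => _ [k bk <-]; rewrite leeNl oppeK.
Qed.

Lemma normalized_count_ge al be eps gam eta T : 0 < eps < 1 -> gam < 1 -> 0 < eta ->
  expR 1 <= T ->
  (empirical T (tau al be) (systole_ge eps) < (1 - gam + 18 * eta)%:E)%E ->
  gam / 18 - eta <= ln T ^+ 2 / T ^+ 2 * (count_small T al be eps)%:R.
Proof.
move=> he gam1 eta0 Te hK.
have e1 : 2 <= expR 1 :> R by have := expR_ge1Dx (1 : R); lra.
have T0 : 0 < T by lra.
have T2 : 0 < T ^+ 2 by rewrite exprn_gt0.
have lT : 1 <= ln T by rewrite -[1]expRK ler_ln ?posrE ?expR_gt0.
set N := (count_small T al be eps)%:R.
have [|h|h] := @count_small_or_recurrent al be eps T he; first lra.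
  (* Here [N >= T ^+ 2 - 1 >= T ^+ 2 / 2], so the normalized count is at least 1/2, which exceeds
     [gam / 18]. *)
  have l2 : 1 <= ln T ^+ 2 by rewrite exprn_ege1.
  have T4 : 4 <= T ^+ 2.
    have : 0 <= (T - 2) * (T + 2) by rewrite mulr_ge0; lra.
    lra.
  apply: (@le_trans _ _ 2^-1); first lra.
  rewrite -/N in h; rewrite mulrAC ler_pdivlMr //.
  apply: (@le_trans _ _ (1 * N)); first lra.
  by rewrite ler_pM2r //; lra.
move: h hK; rewrite /empirical -/(recurrent_times al be eps T) -/N.
(* The area is finite: [-oo] contradicts the lower bound, and [+oo] would make [empirical]
   infinite. *)
case: (mu2 (recurrent_times al be eps T)) => [m| |] //=; last first.
  by rewrite gt0_muley ?lte_fin ?invr_gt0.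
rewrite -EFinD -EFinM lee_fin lte_fin => h1 h2.
(* The triangles cover more than [(gam - 18 * eta) * T ^+ 2]; dividing by 18 leaves the loss
   [eta]. *)
have {}h2 : m < (1 - gam + 18 * eta) * T ^+ 2 by rewrite -ltr_pdivrMr // mulrC.
rewrite mulrAC ler_pdivlMr //; lra.
Qed.

End Counting.

Unset Implicit Arguments.

Theorem theorem1p10 (R : realType) (gam al be : R) (T : nat -> R) :
  0 < gam < 1 ->
  (forall k, 0 < T k) ->
  T @ \oo --> +oo ->
  (forall K : set 'M[R]_3, compactX K ->
     (limn_esup (fun k => empirical (T k) (tau al be) K) <= (1 - gam)%:E)%E) ->
  forall eps : R, 0 < eps < 2^-1 ->
    ((gam / 18)%:E <=
     limn_einf (fun k => ((ln (T k)) ^+ 2 / (T k) ^+ 2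
                          * (count_small (T k) al be eps)%:R)%:E))%E.
Proof.
move=> /andP[gam0 gam1] _ Ty escape eps /andP[e0 e2].
have he : 0 < eps < 1 by rewrite e0 /=; lra.
apply/lee_subgt0Pr => eta eta0; rewrite -EFinB; apply: limn_einf_ge.
(* Escape of mass is applied to one compact set, and [18 * eta] makes the inequality strict, so that
   it holds eventually. *)
have lim : (limn_esup (fun k => empirical (T k) (tau al be) (systole_ge eps))
    < (1 - gam + 18 * eta)%:E)%E.
  apply: le_lt_trans (escape _ (compactX_systole_ge e0)) _.
  by rewrite lte_fin; lra.
have ev := limn_esup_lt lim.
have Tge := (cvgryPge T).1 Ty (expR 1).
near=> k; rewrite lee_fin.
have Tk : expR 1 <= T k by near: k; exact: Tge.
have Kk : (empirical (T k) (tau al be) (systole_ge eps) < (1 - gam + 18 * eta)%:E)%E.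
  by near: k; exact: ev.
exact: normalized_count_ge Kk.
Unshelve. all: by end_near.
Qed.
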